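(* For all integers $m\ge 1$ and $p\ge 1$, $$\langle K_m,p\rangle=\langle K_{m-2},P(b,p)+1\rangle\sqcup\langle K_{m-1},P(a,p)+1\rangle,$$ where $\sqcup$ denotes disjoint union.
   Context: The Fibonacci sequence $\mathbb{F}$ is the infinite word over $\{a,b\}$ that begins with $a$ and is fixed by the morphism $\sigma$ with $\sigma(a)=ab$, $\sigma(b)=a$; letters are indexed from $1$. Put $F_{-1}=b$ and $F_m=\sigma^m(a)$ for $m\ge 0$. Let $\delta_m$ be the last letter of $F_m$. The $m$-th singular word ($m\ge -1$) is $K_m=\delta_{m+1}F_m\delta_m^{-1}$, i.e. $F_m$ with its last letter deleted and $\delta_{m+1}$ prepended; thus $K_{-1}=a$, $K_0=b$, $K_1=aa$, $K_2=bab$. For a nonempty factor $\omega$ of $\mathbb{F}$, $Ker(\omega)$ is the maximal singular word occurring in $\omega$, i.e. $K_m$ with the largest index $m$ such that $K_m$ is a factor of $\omega$. For a factor $\omega$ and $p\ge1$, $P(\omega,p)$ is the position in $\mathbb{F}$ of the last letter of the $p$-th occurrence of $\omega$ (overlapping occurrences allowed, ordered from left to right); in particular $P(a,p)$ and $P(b,p)$ are the positions of the $p$-th letter $a$ and the $p$-th letter $b$. Let $\mathcal{P}$ be the set of palindromes (nonempty words equal to their reversal) occurring in $\mathbb{F}$, and set $\langle K_m,p\rangle=\{P(\omega,p):\omega\in\mathcal{P},\ Ker(\omega)=K_m\}$ for $m\ge -1$, $p\ge 1$. *)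

(* Defs.v *)
From HB Require Import structures.
From mathcomp Require Import all_boot all_order all_algebra.
From mathcomp Require Import classical_sets.

Set Implicit Arguments.
Unset Strict Implicit.
Unset Printing Implicit Defensive.

Import Order.TTheory GRing.Theory Num.Theory.

Local Open Scope ring_scope.

Inductive letter : Set := La | Lb.

Definition bool_of_letter (x : letter) : bool := if x is La then true else false.
Definition letter_of_bool (c : bool) : letter := if c then La else Lb.

Lemma bool_of_letterK : cancel bool_of_letter letter_of_bool.
Proof. by case. Qed.

HB.instance Definition _ := Countable.copy letter (can_type bool_of_letterK).

Notation word := (seq letter).

Definition sigma (w : word) : word :=
  flatten [seq if x is La then [:: La; Lb] else [:: La] | x <- w].

(* [Fw (-1) = b] and [Fw m = sigma^m(a)] for [m >= 0]; indices below -1 are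
   never used. *)
Definition Fw (m : int) : word :=
  if m is Posz n then iter n sigma [:: La] else [:: Lb].

(* The infinite word, with letters indexed from 1 ([fib 0] is never used).
   The words [Fw 0], [Fw 1], ... are prefixes of one another and [Fw i] has more
   than [i] letters, so the default letter of [nth] does not matter; [fibP] below
   identifies [fib] as the fixed point of [sigma] that begins with [La]. *)
Definition fib (i : nat) : letter := nth La (Fw i) i.-1.

Definition prefix_of (x : nat -> letter) (n : nat) : word := map x (iota 1 n).

Definition sigma_fixed (x : nat -> letter) : Prop :=
  forall n, sigma (prefix_of x n) = prefix_of x (size (sigma (prefix_of x n))).

Definition delta (m : int) : letter := last La (Fw m).

Definition K (m : int) : word :=
  delta (m + 1) :: take (size (Fw m)).-1 (Fw m).

(* [Ker w] is total by choice: the default [::], which is not a singular word,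
   is returned only for words without singular factors, i.e. for [w = [::]]. *)
Definition Ker (w : word) : word :=
  xget [::] [set u | exists m : int,
    [/\ -1 <= m, u = K m, infix (K m) w
      & forall k : int, m < k -> ~~ infix (K k) w]].

(* [w] occurs in the infinite word with its last letter at position [i]. *)
Definition occurs_at (w : word) (i : nat) : bool :=
  (size w <= i)%N && (map fib (iota (i - size w).+1 (size w)) == w).

Definition factor (w : word) : Prop := exists i, occurs_at w i.

(* [P w p] is the position of the last letter of the [p]-th occurrence of [w];
   every nonempty factor occurs infinitely often, so for [p >= 1] the default 0
   is returned only when [w] is not a factor. *)
Definition P (w : word) (p : nat) : nat :=
  xget 0%N [set i | occurs_at w i /\ count (occurs_at w) (iota 1 i) = p].

Definition palindrome_factor (w : word) : Prop :=
  [/\ w <> [::], rev w = w & factor w].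

Definition bracket (u : word) (p : nat) : set nat :=
  [set P w p | w in [set w | palindrome_factor w /\ Ker w = u]].

Lemma sigma_cat u v : sigma (u ++ v) = sigma u ++ sigma v.
Proof. by rewrite /sigma map_cat flatten_cat. Qed.

Lemma Fw_S (n : nat) : Fw n.+1 = sigma (Fw n).
Proof. by []. Qed.

Lemma Fw_prefixS (n : nat) : exists x s, Fw n.+1 = Fw n ++ x :: s.
Proof.
elim: n => [|n [x [s IHn]]]; first by exists Lb, [::].
exists La, (behead (sigma (x :: s))).
by rewrite Fw_S [in LHS]IHn sigma_cat -Fw_S; case: x {IHn}.
Qed.

Lemma Fw_prefix (m n : nat) : (m <= n)%N -> prefix (Fw m) (Fw n).
Proof.
move=> /subnK <-; elim: (n - m)%N => [|k IHk]; first exact: prefix_refl.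
apply: (prefix_trans IHk); rewrite addSn.
by have [x [s ->]] := Fw_prefixS (k + m); apply: prefix_prefix.
Qed.

Lemma Fw_size (n : nat) : (n < size (Fw n))%N.
Proof.
elim: n => // n IHn; have [x [s ->]] := Fw_prefixS n.
by rewrite size_cat /= addnS ltnS (leq_trans IHn) ?leq_addr.
Qed.

Lemma prefix_nth (u v : word) i :
  prefix u v -> (i < size u)%N -> nth La v i = nth La u i.
Proof. by case/prefixP=> s -> lt_iu; rewrite nth_cat lt_iu. Qed.

Lemma fib_Fw (n i : nat) : (i < size (Fw n))%N -> fib i.+1 = nth La (Fw n) i.
Proof.
move=> lt_in; rewrite /fib /=; case: (leqP i.+1 n) => [le_in | lt_ni].
  by rewrite (prefix_nth (Fw_prefix le_in)) // (leq_trans _ (Fw_size _)).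
by rewrite (prefix_nth (Fw_prefix (ltnW lt_ni))).
Qed.

Lemma prefix_of_size x n : size (prefix_of x n) = n.
Proof. by rewrite size_map size_iota. Qed.

Lemma prefix_of_nth x n i : (i < n)%N -> nth La (prefix_of x n) i = x i.+1.
Proof. by move=> lt_in; rewrite (nth_map 0%N) ?size_iota ?nth_iota. Qed.

Lemma prefix_of_fib (w : word) (n : nat) :
  prefix w (Fw n) -> w = prefix_of fib (size w).
Proof.
move=> pw; apply: (@eq_from_nth _ La); rewrite ?prefix_of_size // => i lt_i.
rewrite prefix_of_nth // (@fib_Fw n) ?(prefix_nth pw) //.
exact: leq_trans lt_i (size_prefix pw).
Qed.

Lemma fib_fixed : sigma_fixed fib.
Proof.
move=> n; apply: (@prefix_of_fib _ n.+1); rewrite Fw_S.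
have pn: prefix_of fib n = take n (Fw n).
  have le_n: (n <= size (Fw n))%N by exact: ltnW (Fw_size n).
  by have := @prefix_of_fib _ n (prefix_take (Fw n) n); rewrite size_takel.
by rewrite pn -[X in prefix _ (sigma X)](cat_take_drop n) sigma_cat prefix_prefix.
Qed.

Lemma fibP (x : nat -> letter) :
  x 1%N = La /\ sigma_fixed x <-> forall i, (0 < i)%N -> x i = fib i.
Proof.
split=> [[x1 xfix] | xE].
  have xF (n : nat) : Fw n = prefix_of x (size (Fw n)).
    elim: n => [|n IHn]; first by rewrite /prefix_of /= x1.
    by rewrite Fw_S IHn; apply: xfix.
  case=> // i _; rewrite /fib xF prefix_of_nth //.
  exact: ltnW (Fw_size i.+1).
have pE n : prefix_of x n = prefix_of fib n.
  by apply/eq_in_map => i; rewrite mem_iota => /andP[i_gt0 _]; apply: xE.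
split; first by rewrite xE.
by move=> n; rewrite !pE; apply: fib_fixed.
Qed.

(* Main.v *)
Require Import Defs.
From mathcomp Require Import all_boot all_order all_algebra.
From mathcomp Require Import classical_sets.
From mathcomp Require Import zify.

Import Order.TTheory GRing.Theory Num.Theory.
Local Open Scope classical_set_scope.

(** Write [f k] for the length of [Fw k]. The heart of the matter is that the
positions counted in a bracket form an interval ([bracket_interval]): if [o] is
the length of the [k.+1]-st iterate of [sigma] on the first [j] letters, then
the bracket of [K (k - 1)] at [j.+1] consists of the [e] with
[o + f k.+1 <= e + 1 < o + f k.+2].

This comes from desubstitution. The map [tau v = sigma v a] commutes with
reversal, and the occurrences of [tau v] are the images under [sigma] of those
of [v] ([occ_tau]). Its iterates on the empty word are the palindromic prefixes
[central k], whose occurrences start at the boundaries of the blocks of the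
[k]-th iterate of [sigma]. Pulling back a palindromic factor [w] through [tau]
until it becomes the letter [a] shows that [w] is [central k.+1] with fewer than
[f k] letters deleted at each end, and that [w] occurs only inside
[central k.+1] ([palindrome_centred]). The largest possible deletion leaves the
singular word [K (k - 1)] ([Ks_extension]); a singular word of larger index does
not fit into [central k.+1] ([Ks_infix]), so [K (k - 1)] is the kernel of [w]
([Ker_centre]). Thus the kernel determines [k], the palindromes with this kernel
correspond to the [f k] possible deletions, and their [j.+1]-th occurrences all
lie in the same occurrence of [central k.+1].

For the decomposition, the prefix ending with the [j.+1]-st [a] is
[sigma (prefix_of fib j) a], and the prefix ending with the [j.+1]-st [b] is its
image under [sigma] ([lpos_P_La], [lpos_P_Lb]). Hence with [o] the length of the
[k + 3]-rd iterate on the first [j] letters, the bracket of [K (k + 1)] is given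
by [o + f (k + 3) <= e + 1 < o + f (k + 4)], and the two brackets on the right
are its parts below and above [o + 2 * f (k + 2)]. *)

Local Notation pre := (prefix_of fib).

(** Occurrences are recorded by the number of letters before them, so that an
offset of [w] is also the length of the prefix of the infinite word preceding
[w]. *)
Definition occ (w : seq letter) (o : nat) : bool :=
  map fib (iota o.+1 (size w)) == w.

Lemma occ_cons x w o : occ (x :: w) o = (fib o.+1 == x) && occ w o.+1.
Proof. by rewrite /occ /= eqseq_cons. Qed.

Lemma occ_cat v w o : occ (v ++ w) o = occ v o && occ w (o + size v).
Proof.
by rewrite /occ size_cat iotaD map_cat eqseq_cat ?size_map ?size_iota // addSn.
Qed.

Lemma occ_rcons x w o :
  occ (rcons w x) o = occ w o && (fib (o + size w).+1 == x).
Proof. by rewrite -cats1 occ_cat occ_cons andbT. Qed.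

Lemma pre_cat v o : occ v o -> pre (o + size v) = pre o ++ v.
Proof. by move=> /eqP ov; rewrite /prefix_of iotaD map_cat add1n ov. Qed.

Lemma occ_Fw (k : nat) : occ (Fw k) 0.
Proof. by rewrite /occ [X in _ == X](prefix_of_fib (prefix_refl (Fw k))). Qed.

Lemma occurs_atE w i : occurs_at w i = (size w <= i) && occ w (i - size w).
Proof. by []. Qed.

Lemma letter_neq (x y : letter) :
  x != y -> x = La /\ y = Lb \/ x = Lb /\ y = La.
Proof. by case: x y => [] [] //; [left | right]. Qed.

(** * The morphism on positions *)

Lemma sigma_rcons v x : sigma (rcons v x) = sigma v ++ sigma [:: x].
Proof. by rewrite -cats1 sigma_cat. Qed.

Lemma size_sigma v : size (sigma v) = size v + count_mem La v.
Proof.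
elim: v => //= x v IHv; rewrite -[x :: v]cat1s sigma_cat size_cat IHv.
by case: x => /=; lia.
Qed.

(** Both [La :: rev (sigma [:: x])] and [rcons (sigma [:: x]) La] are [aba] when
[x = La] and [aa] when [x = Lb]. *)
Lemma rev_sigma v : La :: rev (sigma v) = rcons (sigma (rev v)) La.
Proof.
elim: v => //= x v IHv; rewrite -[x :: v]cat1s sigma_cat rev_cat rev_cons.
by rewrite sigma_rcons -cat_cons IHv; case: x; rewrite -!cats1 -!catA.
Qed.

(** Every [sigma]-block begins with [a], so the image of an occurrence of [v] is
followed by [a]. With this letter appended, images are compatible with reversal,
and they occur only as images of occurrences of [v]. *)
Definition tau v := rcons (sigma v) La.

Lemma rev_tau v : rev (tau v) = tau (rev v).
Proof. by rewrite /tau rev_rcons rev_sigma. Qed.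

Lemma tau_cons x v : tau (x :: v) = sigma [:: x] ++ tau v.
Proof. by rewrite /tau -[x :: v]cat1s sigma_cat rcons_cat. Qed.

Lemma tau_head v : exists s, tau v = La :: s.
Proof. by case: v => [|[] v]; rewrite ?tau_cons /=; eexists. Qed.

Lemma tau_inj : injective tau.
Proof.
elim=> [|x v IHv] [|y v'] //=.
- by rewrite tau_cons; have [s ->] := tau_head v'; case: y.
- by rewrite tau_cons; have [s ->] := tau_head v; case: x.
rewrite !tau_cons; have [s E] := tau_head v; have [s' E'] := tau_head v'.
case: x y => [] [] /=.
- by case=> /IHv->.
- by rewrite E'.
- by rewrite E.
by case=> /IHv->.
Qed.

(** The offset of the block of [sigma] that comes from the letter [fib j.+1]. *)
Definition spos j := size (sigma (pre j)).

Lemma pre_spos j : pre (spos j) = sigma (pre j).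
Proof. by rewrite /spos -fib_fixed. Qed.

Lemma pre_succ j : pre j.+1 = rcons (pre j) (fib j.+1).
Proof. by rewrite /prefix_of -[j.+1]addn1 iotaD map_cat cats1 add1n addn1. Qed.

Lemma spos_S j : spos j.+1 = spos j + size (sigma [:: fib j.+1]).
Proof. by rewrite /spos pre_succ sigma_rcons size_cat. Qed.

Lemma spos_add v j : occ v j -> spos (j + size v) = spos j + size (sigma v).
Proof. by move=> ov; rewrite /spos pre_cat // sigma_cat size_cat. Qed.

Lemma spos_lt i j : i < j -> spos i < spos j.
Proof.
move: i j; apply: (homo_ltn ltn_trans) => n.
by rewrite spos_S; case: (fib _) => /=; lia.
Qed.

Lemma spos_le i j : i <= j -> spos i <= spos j.
Proof. by rewrite leq_eqVlt => /predU1P[-> //|/spos_lt/ltnW]. Qed.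

Lemma occ_block j : occ (sigma [:: fib j.+1]) (spos j).
Proof.
have := pre_spos j.+1; rewrite pre_succ sigma_rcons spos_S.
rewrite -pre_spos /prefix_of iotaD map_cat.
by move/eqP; rewrite eqseq_cat // => /andP[_]; rewrite add1n.
Qed.

Lemma fib_spos j : fib (spos j).+1 = La.
Proof.
by have := occ_block j; case: (fib j.+1); rewrite /= !occ_cons => /andP[/eqP].
Qed.

Lemma fib_spos2 j : fib j.+1 = La -> fib (spos j).+2 = Lb.
Proof. by have := occ_block j => + E; rewrite E !occ_cons => /and3P[_ /eqP]. Qed.

(** Each block is [a] or [ab]: an offset either starts a block or is the middle of
a block [ab]. *)
Lemma position_cases o :
  exists j, o = spos j \/ o = (spos j).+1 /\ fib j.+1 = La.
Proof.
elim: o => [|o [j [->|[-> fj]]]]; first by exists 0; left.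
  case E : (fib j.+1); first by exists j; right.
  by exists j.+1; left; rewrite spos_S E addn1.
by exists j.+1; left; rewrite spos_S fj addn2.
Qed.

Lemma fib_La o : fib o.+1 = La -> exists j, o = spos j.
Proof.
by have [j [->|[-> /fib_spos2->]]] := position_cases o; first by exists j.
Qed.

Lemma fib_Lb o : fib o.+1 = Lb -> exists2 j, o = (spos j).+1 & fib j.+1 = La.
Proof.
by have [j [->|[-> fj]]] := position_cases o; rewrite ?fib_spos //; exists j.
Qed.

Lemma fib_after_Lb o : fib o.+1 = Lb -> fib o.+2 = La.
Proof. by case/fib_Lb=> j -> fj; rewrite -(fib_spos j.+1) spos_S fj addn2. Qed.

(** The blocks [ab] and [a] are told apart by the letter that follows their [a],
and that letter is inside [tau v]; hence [v] can be read back block by block. *)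
Lemma occ_tau_spos v j : occ (tau v) (spos j) = occ v j.
Proof.
elim: v j => [|x v IHv] j; first by rewrite occ_cons fib_spos.
rewrite tau_cons occ_cat occ_cons -IHv spos_S.
have [<-|ne] := eqVneq (fib j.+1) x; first by rewrite occ_block.
have [s E] := tau_head v.
case: (letter_neq _ _ ne) => -[fj ->].
  by rewrite E /= addn1 !occ_cons fib_spos2 // andbF.
have := fib_spos j.+1; rewrite spos_S fj addn1 => fa.
by rewrite /= !occ_cons fa andbF.
Qed.

(** Together with [occ_tau_spos]: the occurrences of [tau v] are exactly the images
of those of [v]. *)
Lemma occ_tau v o : occ (tau v) o -> exists2 j, o = spos j & occ v j.
Proof.
move=> ov; have [s E] := tau_head v.
have : fib o.+1 = La by move: ov; rewrite E occ_cons => /andP[/eqP].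
by case/fib_La=> j Ej; exists j; rewrite // -occ_tau_spos -Ej.
Qed.

(** A factor that starts at a block boundary and ends with [a] is a union of whole
blocks followed by the first letter of the next one. *)
Lemma occ_desubst w j :
  occ (rcons w La) (spos j) -> exists v, rcons w La = tau v.
Proof.
have [n] := ubnP (size w); elim: n w j => // n IHn [|x w] j /= lt_wn.
  by exists [::].
rewrite occ_cons fib_spos => /andP[/eqP <-].
case E : (fib j.+1).
  case: w lt_wn => [|y w] lt_wn;
    rewrite occ_cons fib_spos2 //= => /andP[/eqP <-].
  have -> : (spos j).+2 = spos j.+1 by rewrite spos_S E addn2.
  by case/IHn=> [|v ->]; [move: lt_wn => /=; lia | exists (La :: v)].
have -> : (spos j).+1 = spos j.+1 by rewrite spos_S E addn1.
case/IHn=> [|v Ev]; first lia.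
by exists (Lb :: v); rewrite tau_cons -Ev.
Qed.

(** * Central words *)

(** These are the palindromic prefixes [empty, a, aba, abaaba, ...] of the infinite
word: [central k] is [Fw k.+1] without its last two letters. *)
Fixpoint central (k : nat) : seq letter :=
  if k is k'.+1 then tau (central k') else [::].

(** The offset of the block of the [k]-th iterate of [sigma] that comes from the
letter [fib j.+1]. By [occ_tau], the [lpos k j] are the offsets of [central k],
since the empty word [central 0] occurs everywhere. *)
Definition lpos k j := size (iter k sigma (pre j)).

Lemma rev_central k : rev (central k) = central k.
Proof. by elim: k => //= k IHk; rewrite rev_tau IHk. Qed.

Lemma Fw_central (k : nat) :
  Fw k.+1 = central k ++ [:: La; Lb] \/ Fw k.+1 = central k ++ [:: Lb; La].
Proof.
elim: k => [|k IHk]; first by left.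
by rewrite Fw_S; case: IHk => ->;
  rewrite sigma_cat [central k.+1]/= /tau -cats1 -!catA; [right | left].
Qed.

Lemma size_central (k : nat) : (size (central k)).+2 = size (Fw k.+1).
Proof. by case: (Fw_central k) => ->; rewrite size_cat addn2. Qed.

Lemma occ_central0 k : occ (central k) 0.
Proof.
by have := occ_Fw k.+1; case: (Fw_central k) => ->; rewrite occ_cat => /andP[].
Qed.

Lemma pre_lpos k j : pre (lpos k j) = iter k sigma (pre j).
Proof.
elim: k => [|k IHk]; first by rewrite /lpos /= prefix_of_size.
by rewrite /lpos /= -IHk -/(spos _) pre_spos.
Qed.

Lemma lpos_S k j : lpos k.+1 j = spos (lpos k j).
Proof. by rewrite /spos pre_lpos. Qed.

Lemma lpos_0 j : lpos 0 j = j.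
Proof. exact: prefix_of_size. Qed.

Lemma occ_central k j : occ (central k) (lpos k j).
Proof. by elim: k => // k IHk; rewrite lpos_S occ_tau_spos. Qed.

Lemma iter_sigma_cat k u v :
  iter k sigma (u ++ v) = iter k sigma u ++ iter k sigma v.
Proof. by elim: k => //= k ->; rewrite sigma_cat. Qed.

Lemma Fw_SS (k : nat) : Fw k.+2 = Fw k.+1 ++ Fw k.
Proof.
by elim: k => // k IHk; rewrite Fw_S [in LHS]IHk sigma_cat.
Qed.

Lemma size_FwS (k : nat) : size (Fw k.+1) = spos (size (Fw k)).
Proof. by rewrite /spos -(prefix_of_fib (prefix_refl (Fw k))). Qed.

(** * Palindromes as centred factors of central words *)

(** [w] is obtained from [central k.+1] by deleting [u] on the left and its reversal
on the right, with fewer than [size (Fw k)] letters on each side, and every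
occurrence of [w] extends to one of [central k.+1]. The size bound is what fixes
[k]: it says that [w] still contains the singular word of index [k - 1] at the
centre of [central k.+1]. *)
Definition centred (k : nat) u w : Prop :=
  [/\ central k.+1 = u ++ w ++ rev u, size u < size (Fw k)
    & forall o, occ w o -> exists j, o = lpos k.+1 j + size u].

Lemma centred_occ k u w : central k.+1 = u ++ w ++ rev u ->
  forall j, occ u (lpos k.+1 j) /\ occ w (lpos k.+1 j + size u).
Proof.
by move=> E j; have := occ_central k.+1 j; rewrite E !occ_cat => /and3P[].
Qed.

Lemma centred0 : centred 0 [::] [:: La].
Proof.
split=> // o; rewrite occ_cons => /andP[/eqP/fib_La[j ->] _].
by exists j; rewrite addn0 lpos_S lpos_0.
Qed.

Lemma lpos_n0 k : lpos k 0 = 0.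
Proof. by elim: k => [|k IHk]; rewrite ?lpos_0 ?lpos_S ?IHk. Qed.

Lemma size_sigma_prefix k u w : central k.+1 = u ++ w ++ rev u ->
  size (sigma u) = spos (size u).
Proof.
move=> E; have [ou _] := centred_occ k u w E 0.
by move: ou; rewrite lpos_n0 => /spos_add; rewrite add0n => ->.
Qed.

(** The bound on the deleted part survives because [u] is a proper prefix of
[Fw k], whose image is [Fw k.+1]. *)
Lemma centred_tau k u w : centred k u w -> centred k.+1 (sigma u) (tau w).
Proof.
case=> E lt_u wP; split.
- rewrite [LHS]/= -/(central k.+1) E /tau !sigma_cat -!cats1 -!catA.
  by rewrite cats1 -rev_sigma -cat_rcons -cats1 -catA.
- by rewrite size_FwS (size_sigma_prefix _ _ _ E) spos_lt.
move=> o /occ_tau[i -> /wP[j ->]]; exists j.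
by have [ou _] := centred_occ _ _ _ E j; rewrite spos_add // -lpos_S.
Qed.

(** A palindrome that begins with [b] is not an image under [tau], but every [b] has
an [a] on both sides: it is the inner part of an image [a z a] with the same
occurrences up to a shift by one. One more letter can be deleted because
[rcons u La] is still a prefix of [Fw k]. *)
Lemma centred_trim_tau k u w :
  centred k u (La :: w) -> rev (La :: w) = La :: w ->
  exists z, tau (La :: w) = La :: rcons z La
    /\ centred k.+1 (rcons (sigma u) La) z.
Proof.
move=> cen pal; have [E lt_u wP] := cen.
have [E' _ tP] := centred_tau _ _ _ cen.
have Ez : tau (La :: w) = La :: rcons (Lb :: sigma w) La by [].
exists (Lb :: sigma w); split=> //; split.
- by rewrite E' Ez rev_rcons cat_cons !cat_rcons.
- have [ou ow] := centred_occ _ _ _ E 0; rewrite lpos_n0 !add0n in ou ow.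
  have ou' : occ (rcons u La) 0.
    by rewrite occ_rcons ou; move: ow; rewrite occ_cons => /andP[].
  rewrite size_FwS (leq_trans _ (spos_le _ _ lt_u)) //.
  move: (spos_add _ _ ou'); rewrite add0n size_rcons => ->.
  by rewrite sigma_rcons size_rcons size_cat /= addn2.
move=> o oz.
have /fib_Lb[i Eo fi] : fib o.+1 = Lb.
  by move: oz; rewrite occ_cons => /andP[/eqP].
have /tP[j Ej] : occ (tau (La :: w)) (spos i).
  rewrite Ez occ_cons fib_spos eqxx andTb -Eo occ_rcons oz andTb; apply/eqP.
  rewrite [size _]/= addnS; apply: fib_after_Lb.
  have lastb : last Lb (sigma w) = Lb.
    have : last La (sigma (La :: w)) = Lb.
      by rewrite -pal rev_cons sigma_rcons last_cat.
    by [].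
  by move: oz; rewrite lastI occ_rcons lastb size_belast => /andP[_ /eqP].
by exists j; rewrite Eo Ej size_rcons addnS.
Qed.

Lemma palindrome_rcons (w : seq letter) x : rev (x :: w) = x :: w ->
  exists v, x :: w = rcons v x.
Proof. by move=> <-; rewrite rev_cons; eexists. Qed.

(** Desubstitution: a palindrome with extremal letter [a] is [tau t] for a shorter
palindrome [t]. A palindrome with extremal letter [b] becomes such an image once
the forced letters [a] are added at both ends. The word [t] is then no longer
than [w] and begins with [a], so the measure counts an initial [b] as half a
letter. *)
Lemma palindrome_centred w o : w <> [::] -> rev w = w -> occ w o ->
  exists k u, centred k u w.
Proof.
have [n] := ubnP (2 * size w + (head La w == Lb)).
elim: n w o => // n IHn [//|[] w] o lt_wn _ pal ow.
  have [v Ev] := palindrome_rcons _ _ pal.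
  have /fib_La[j Ej] : fib o.+1 = La.
    by move: ow; rewrite occ_cons => /andP[/eqP].
  have [] := occ_desubst v j; first by rewrite -Ev -Ej.
  rewrite -Ev => t Et; have [t0|/eqP nt] := eqVneq t [::].
    by rewrite Et t0; exists 0, [::]; exact: centred0.
  have lt_t : size t < (size w).+1.
    by have := congr1 size Et; rewrite /= size_rcons size_sigma; lia.
  have [||||k [u cu]] := IHn t j => //.
  - by move: lt_wn => /=; lia.
  - by apply: tau_inj; rewrite -rev_tau -Et.
  - by rewrite -occ_tau_spos -Et -Ej.
  by rewrite Et; exists k.+1, (sigma u); exact: centred_tau.
have /fib_Lb[j Ej fj] : fib o.+1 = Lb.
  by move: ow; rewrite occ_cons => /andP[/eqP].
have oaw : occ (rcons (La :: Lb :: w) La) (spos j).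
  rewrite occ_rcons occ_cons fib_spos -Ej ow /=; apply/eqP.
  have [v Ev] := palindrome_rcons _ _ pal.
  rewrite addnS; move: ow; rewrite [size _]/= addnS Ev occ_rcons.
  have := congr1 size Ev; rewrite /= size_rcons => -[->] /andP[_ /eqP].
  by rewrite Ej addSn; apply: fib_after_Lb.
have [t Et] := occ_desubst _ _ oaw.
case: t Et => [|[] t] Et.
- by [].
- have Er : rev (La :: t) = La :: t.
    apply: tau_inj; rewrite -rev_tau -Et rev_rcons rev_cons pal.
    by rewrite rcons_cons.
  have [||||k [u cu]] := IHn (La :: t) j => //.
  - have := congr1 size Et; rewrite /= !size_rcons /= size_sigma.
    by move: lt_wn => /=; lia.
  - by rewrite -occ_tau_spos -Et.
  have [z [Ez cz]] := centred_trim_tau _ _ _ cu Er.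
  have Ezw : Lb :: w = z.
    by apply: (@rcons_injl _ La); move: Et; rewrite Ez => /(congr1 behead).
  by rewrite Ezw; exists k.+1, (rcons (sigma u) La).
by have [s E] := tau_head t; move: Et; rewrite tau_cons E.
Qed.

(** * Singular words *)

Lemma size_K m : size (K m) = size (Fw m).
Proof.
rewrite /K /= size_takel ?leq_pred // prednK //.
by case: m => [k|k] //; apply: leq_ltn_trans (Fw_size k).
Qed.

(* With the index shifted by one, the singular words are the [Ks k], [k : nat]. *)
Local Notation Ks k := (K (k%:Z - 1)).

Lemma size_Ks_ext (k : nat) :
  size (Ks k) + 2 * (size (Fw k)).-1 = size (central k.+1).
Proof.
have := size_central k.+1; rewrite size_K Fw_SS size_cat; have := Fw_size k.
case: k => [|k] //; have -> : (k.+1%:Z - 1 = k)%R by lia.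
by rewrite Fw_SS size_cat; lia.
Qed.

(** The prefix [Fw k.+1 = Fw k ++ Fw (k - 1)] of the infinite word shows [Ks k]: the
last letter of [Fw k] followed by [Fw (k - 1)] without its last letter. *)
Lemma occ_Ks (k : nat) : occ (Ks k) (size (Fw k)).-1.
Proof.
case: k => [|k] //; have -> : (k.+1%:Z - 1 = k)%R by lia.
rewrite /K; have -> : (k%:Z + 1 = k.+1)%R by lia.
have := occ_Fw k.+2; rewrite Fw_SS.
rewrite -{1}(cat_take_drop (size (Fw k)).-1 (Fw k)).
rewrite /delta; case: (lastP (Fw k.+1)) (Fw_size k.+1) => // v x _.
rewrite last_rcons size_rcons cat_rcons -cat_cons catA occ_cat => /andP[].
by rewrite occ_cat => /andP[_].
Qed.

(** Deleting as many letters as [centred] permits leaves the singular word. Starting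
from [a], apply [centred_tau], and trim as in [centred_trim_tau] when the first
letter is [a]; the number of deleted letters stays maximal, because [u] followed
by the first letter of [w] is always the whole of [Fw k]. *)
Lemma Ks_extension (k : nat) :
  exists u, size u = (size (Fw k)).-1 /\ centred k u (Ks k).
Proof.
suff [u [w [su cw pw]]] : exists u w,
    [/\ size u = (size (Fw k)).-1, centred k u w & rev w = w].
  exists u; split=> //; suff -> : Ks k = w by [].
  have [E _ _] := cw; have [_] := centred_occ _ _ _ E 0.
  rewrite lpos_n0 add0n /occ su.
  have -> : size w = size (Ks k).
    by have := size_Ks_ext k; rewrite E !size_cat size_rev su; lia.
  by move=> /eqP <-; apply/esym/eqP/occ_Ks.
elim: k => [|k [u [w [su cu pw]]]].
  by exists [::], [:: La]; split=> //; exact: centred0.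
have [E _ _] := cu; have [ou ow] := centred_occ _ _ _ E 0.
rewrite lpos_n0 !add0n in ou ow.
have gt0 : 0 < size (Fw k) by exact: leq_ltn_trans (Fw_size k).
case: w => [|x w] in E ow cu pw *.
  have := size_Ks_ext k; rewrite E !size_cat size_rev su /K /=; lia.
have Su : size (Fw k.+1) = size (sigma u) + size (sigma [:: x]).
  have <- : size (sigma (rcons u x)) = size (sigma u) + size (sigma [:: x]).
    by rewrite sigma_rcons size_cat.
  have := spos_add (rcons u x) 0.
  rewrite add0n size_rcons su (prednK gt0) -size_FwS.
  by apply; rewrite occ_rcons ou; move: ow; rewrite occ_cons => /andP[].
case: x => [] in E ow cu pw Su *.
  have [z [Ez cz]] := centred_trim_tau _ _ _ cu pw.
  exists (rcons (sigma u) La), z; split=> //.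
    by rewrite Su addn2 size_rcons.
  have := rev_tau (La :: w); rewrite pw Ez rev_cons rev_rcons rcons_cons.
  by move=> /(congr1 behead); apply: rcons_injl.
exists (sigma u), (tau (Lb :: w)); split.
- by rewrite Su addn1.
- exact: centred_tau.
by rewrite rev_tau pw.
Qed.

(** * Kernels *)

Lemma infix_occ (v w : seq letter) o : infix v w -> occ w o -> exists i,
  occ v (o + i) /\ i + size v <= size w.
Proof.
case/infixP=> p [s ->]; rewrite !occ_cat => /and3P[_ ov _].
by exists (size p); split=> //; rewrite !size_cat addnA leq_addr.
Qed.

(** A singular word is preceded by at least [size (Fw k') - 1] letters wherever it
occurs, and these letters together with [Ks k'] itself fit into the prefix
[central k.+1] only if [k' <= k]. *)
Lemma Ks_infix (k k' : nat) : infix (Ks k') (central k.+1) -> k' <= k.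
Proof.
move=> /infix_occ/(_ (occ_central0 _))[i []]; rewrite add0n => oi le_i.
have [u [su [_ _ uP]]] := Ks_extension k'; have [j Ej] := uP _ oi.
rewrite leqNgt; apply/negP => lt_k.
have le_F : size (Fw k.+2) <= size (Fw k'.+1).
  by apply/size_prefix/Fw_prefix.
have := size_Ks_ext k'; have := size_central k'.+1; rewrite Fw_SS size_cat.
by have := Fw_size k'; have := size_central k.+1; lia.
Qed.

Lemma Ks_infix_centre k u w :
  central k.+1 = u ++ w ++ rev u -> size u < size (Fw k) -> infix (Ks k) w.
Proof.
move=> E lt_u; have [v [sv [Ev _ _]]] := Ks_extension k.
apply/infixP; set d := size v - size u.
have le : size u <= size v by rewrite sv; lia.
exists (take d w), (drop (size (Ks k) + d) w).
have {1}<- : take (size (Ks k)) (drop d w) = Ks k.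
  have : drop (size u) (central k.+1) = w ++ rev u by rewrite E drop_size_cat.
  have : drop (size v) (central k.+1) = Ks k ++ rev v.
    by rewrite Ev drop_size_cat.
  have -> : size v = d + size u by rewrite /d subnK.
  rewrite -drop_drop => + Eu; rewrite {}Eu drop_cat.
  have sz : size w = size (Ks k) + 2 * d.
    have := congr1 size E; have := congr1 size Ev.
    rewrite /d !size_cat !size_rev; lia.
  have -> : d < size w by have K0 : 0 < size (Ks k) by []; lia.
  move/(congr1 (take (size (Ks k)))); rewrite takel_cat.
    by rewrite take_size_cat.
  by rewrite size_drop sz; lia.
by rewrite -drop_drop !cat_take_drop.
Qed.

Lemma Ker_unique w (k : nat) : infix (Ks k) w ->
  (forall k' : nat, infix (Ks k') w -> k' <= k) -> Ker w = Ks k.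
Proof.
move=> iw maxk; rewrite /Ker; apply: xget_unique.
  exists (k%:Z - 1)%R; split=> //; first lia.
  move=> j lt_j; apply/negP=> ij.
  have Ej : (j = `|(j + 1)%R|%N%:Z - 1)%R by lia.
  by move: ij; rewrite Ej => /maxk; lia.
move=> v [j [ge_j -> ij maxj]].
have Ej : (j = `|(j + 1)%R|%N%:Z - 1)%R by lia.
move: ij; rewrite {1}Ej => /maxk le_k.
have [->//|ne] := eqVneq j (k%:Z - 1)%R.
by have /maxj/negP[] : (j < k%:Z - 1)%R by lia.
Qed.

Lemma Ker_centre k u w :
  central k.+1 = u ++ w ++ rev u -> size u < size (Fw k) -> Ker w = Ks k.
Proof.
move=> E lt_u; apply: Ker_unique; first exact: Ks_infix_centre E lt_u.
move=> k' ik; apply: Ks_infix; apply: infix_trans ik _.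
by rewrite E; apply/infixP; exists u, (rev u).
Qed.

Lemma Ks_inj (k k' : nat) : Ks k = Ks k' -> k = k'.
Proof.
have le i j : Ks i = Ks j -> i <= j.
  have [v [_ [E _ _]]] := Ks_extension j.
  by move=> Ei; apply: Ks_infix; rewrite E Ei; apply/infixP; exists v, (rev v).
by move=> E; apply/eqP; rewrite eqn_leq !le.
Qed.

(** * Positions of palindromes *)

(** An increasing enumeration of all end positions of [w] gives [P w]. *)
Lemma P_enum w (f : nat -> nat) : w <> [::] ->
  (forall i j, i < j -> f i < f j) ->
  (forall i, occurs_at w i <-> exists j, i = f j) ->
  forall j, P w j.+1 = f j.
Proof.
move=> w0 flt fP j; rewrite /P.
have f_gt0 i : 0 < f i.
  have : occurs_at w (f i) by apply/fP; exists i.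
  by rewrite occurs_atE => /andP[]; case: w {fP} w0 => //= *; lia.
have fle i i' : (f i <= f i') = (i <= i').
  apply/idP/idP; first by apply: contraLR; rewrite -!ltnNge; exact: flt.
  by rewrite leq_eqVlt => /predU1P[->//|/flt/ltnW].
have cf i : count (occurs_at w) (iota 1 (f i)) = i.+1.
  rewrite -size_filter.
  suff -> : [seq x <- iota 1 (f i) | occurs_at w x] = map f (iota 0 i.+1).
    by rewrite size_map size_iota.
  apply: (@irr_sorted_eq _ ltn); [exact: ltn_trans | exact: ltnn | | |].
  - by apply: sorted_filter (iota_ltn_sorted _ _); exact: ltn_trans.
  - rewrite sorted_map; apply: sub_sorted (iota_ltn_sorted 0 i.+1).
    by move=> x y; exact: flt.
  move=> x; rewrite mem_filter mem_iota add1n ltnS.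
  apply/idP/mapP => [/andP[/fP[i' ->]]|[i' + ->]].
    by rewrite fle => /andP[_ le_i]; exists i'; rewrite // mem_iota add0n ltnS.
  rewrite mem_iota add0n ltnS fle f_gt0 => /= ->; rewrite andbT.
  by apply/fP; exists i'.
apply: xget_unique; first by split; [apply/fP; exists j | exact: cf].
by move=> i [/fP[i' ->]]; rewrite cf => -[->].
Qed.

Lemma P_centred k u w j : centred k u w -> w <> [::] ->
  P w j.+1 = lpos k.+1 j + size u + size w.
Proof.
move=> [E lt_u wP] w0.
apply: (P_enum w (fun j => lpos k.+1 j + size u + size w)) => // [i i' lt_i|i].
  rewrite -!addnA ltn_add2r; elim: k.+1 => [|n IHn]; rewrite ?lpos_0 // !lpos_S.
  exact: spos_lt.
rewrite occurs_atE; split=> [/andP[le_i /wP[j' Ej]]|[j' ->]].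
  by exists j'; rewrite -Ej subnK.
by rewrite leq_addl addnK; have [] := centred_occ _ _ _ E j'.
Qed.

Lemma factor_occ w : factor w <-> exists o, occ w o.
Proof.
split=> [[i]|[o ow]].
  by rewrite occurs_atE => /andP[_]; exists (i - size w).
by exists (o + size w); rewrite occurs_atE leq_addl addnK.
Qed.

(** The palindromes with kernel [Ks k] are the words left by deleting [d] letters at
both ends of [central k.+1], for [d < size (Fw k)]. Their [j.+1]-th occurrences
sit in the same occurrence of [central k.+1], so as [d] varies the end positions
run through an interval. *)
Lemma bracket_interval (k j : nat) : bracket (Ks k) j.+1 =
  [set e | lpos k.+1 j + size (Fw k.+1) <= e.+1 < lpos k.+1 j + size (Fw k.+2)].
Proof.
apply/seteqP; split=> [_ [w [[w0 pw /factor_occ[o ow]] Kw] <-]|e].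
  have [k' [u cu]] := palindrome_centred w o w0 pw ow.
  have [E lt_u _] := cu.
  have Ek : k' = k by apply: Ks_inj; rewrite -Kw (Ker_centre _ _ _ E).
  rewrite Ek in cu E lt_u *; rewrite (P_centred _ _ _ _ cu) //.
  have := congr1 size E; rewrite !size_cat size_rev.
  rewrite /mkset Fw_SS size_cat; have := size_central k.+1.
  by rewrite Fw_SS size_cat; lia.
rewrite [_ e]/mkset => /andP[ge_e lt_e].
(* The occurrence of [central k.+1] in question ends [d] letters after [e]. *)
pose d := lpos k.+1 j + size (Fw k.+2) - e.+2.
pose c := central k.+1; pose w := take (size c - 2 * d) (drop d c).
have Fk := congr1 size (Fw_SS k); rewrite size_cat in Fk.
have lt_d : d < size (Fw k) by rewrite /d; lia.
have szc := size_central k.+1; rewrite -/c in szc.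
have le_d : 2 * d < size c.
  by have K0 : 0 < size (Ks k) by []; have := size_Ks_ext k; rewrite -/c; lia.
have pc : rev c = c by exact: rev_central.
have Erev : rev (take d c) = drop (size c - d) c by rewrite rev_take pc.
have Ec : c = take d c ++ w ++ rev (take d c).
  rewrite Erev; have -> : size c - d = (size c - 2 * d) + d by lia.
  by rewrite -drop_drop !cat_take_drop.
have pw : rev w = w.
  have := congr1 rev Ec; rewrite pc {1}Ec !rev_cat revK -catA => /eqP.
  by rewrite eqseq_cat // eqseq_cat ?size_rev // => /and3P[_ /eqP].
have su : size (take d c) = d by rewrite size_takel; lia.
have w0 : w <> [::].
  move=> /(congr1 size); have := congr1 size Ec.
  by rewrite !size_cat size_rev su /=; lia.
have [_ ow] := centred_occ _ _ _ Ec 0.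
have Kw : Ker w = Ks k by apply: (Ker_centre _ _ _ Ec); rewrite su.
have [k' [u cu]] := palindrome_centred _ _ w0 pw ow.
have [E lt_u _] := cu.
have Ek : k' = k by apply: Ks_inj; rewrite -Kw (Ker_centre _ _ _ E).
rewrite Ek in cu E lt_u *.
exists w; first by split=> //; split=> //; apply/factor_occ; eexists; exact: ow.
rewrite (P_centred _ _ _ _ cu) //.
have := congr1 size E; have := congr1 size Ec.
by rewrite -/c !size_cat !size_rev su /d; lia.
Qed.

(** The prefix that ends with the [j.+1]-st [a] is [sigma (pre j)] followed by [a]. *)
Lemma lpos_P_La k j : lpos k (P [:: La] j.+1) = lpos k.+1 j + size (Fw k).
Proof.
rewrite (P_centred _ _ _ _ centred0) // addn0.
have oa : occ [:: La] (lpos 1 j) by rewrite (occ_central 1 j).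
rewrite /lpos -/(lpos 1 j) (pre_cat _ _ oa).
by rewrite iter_sigma_cat size_cat pre_lpos -iterSr.
Qed.

(** The [j.+1]-st [b] ends the image of the [j.+1]-st [a]. *)
Lemma P_Lb j : P [:: Lb] j.+1 = spos (P [:: La] j.+1).
Proof.
have [z [Ez cz]] := centred_trim_tau _ _ _ centred0 (erefl _).
have Ezb : [:: Lb] = z by apply: (@rcons_injl _ La); case: Ez.
rewrite -Ezb in cz; rewrite (P_centred _ _ _ _ cz) //.
rewrite (P_centred _ _ _ _ centred0) //=.
have oa : occ [:: La] (lpos 1 j) by rewrite (occ_central 1 j).
by rewrite addn0 (spos_add _ _ oa) lpos_S -addnA.
Qed.

Lemma lpos_P_Lb k j : lpos k (P [:: Lb] j.+1) = lpos k.+2 j + size (Fw k.+1).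
Proof. by rewrite P_Lb -lpos_P_La /lpos pre_spos -iterSr. Qed.

Local Open Scope ring_scope.

Theorem mainTheorem5 (m : int) (p : nat) (hm : 1 <= m) (hp : (1 <= p)%N) :
  bracket (K m) p =
    bracket (K (m - 2)) (P [:: Lb] p + 1)%N `|`
    bracket (K (m - 1)) (P [:: La] p + 1)%N
  /\
  bracket (K (m - 2)) (P [:: Lb] p + 1)%N `&`
    bracket (K (m - 1)) (P [:: La] p + 1)%N = set0.
Proof.
case: p hp => // j _.
have [k ->] : exists k : nat, m = k.+2%:Z - 1 by exists `|m - 1|%N; lia.
have -> : k.+2%:Z - 1 - 2 = k%:Z - 1 by lia.
have -> : k.+2%:Z - 1 - 1 = k.+1%:Z - 1 by lia.
rewrite !addn1 !bracket_interval lpos_P_La lpos_P_Lb !Fw_SS !size_cat.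
split; apply/seteqP; split=> e /=; lia.
Qed.
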